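(* Let $n>1$ be an odd integer. A $(K_2,K_{1,n})$-$URD(v;1,s)$ exists if and only if $v \equiv 2(n+1) \pmod{n(n+1)}$.
   Context: For graphs $H_1,H_2$, an $(H_1,H_2)$-$URD(v;r,s)$ is a decomposition of the edge set of the complete graph $K_v$ into edge-disjoint subgraphs (blocks), where the blocks are partitioned into $r+s$ classes, each class being a spanning collection of vertex-disjoint blocks (every vertex of $K_v$ lies in exactly one block of the class), such that $r$ classes consist only of copies of $H_1$ and $s$ classes consist only of copies of $H_2$. Here $K_2$ is a single edge (so a class of copies of $K_2$ is a 1-factor, i.e. a perfect matching) and $K_{1,n}$ is the star with $n$ edges ($n$-star). *)

(* Defs.v *)
From mathcomp Require Import all_boot.
Set Implicit Arguments. Unset Strict Implicit. Unset Printing Implicit Defensive.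

(* Vertices of K_v are 'I_v; an edge is a 2-element vertex set;
   a block (subgraph) is a set of edges; a class is a set of blocks. *)
Definition edge v := {set 'I_v}.
Definition block v := {set {set 'I_v}}.

Definition bverts v (B : block v) : {set 'I_v} := \bigcup_(e in B) e.

Definition isK2 v (B : block v) : Prop :=
  exists x y : 'I_v, x != y /\ B = [set [set x; y]].

Definition isStar (n : nat) v (B : block v) : Prop :=
  exists (c : 'I_v) (L : {set 'I_v}),
    [/\ #|L| = n, c \notin L & B = [set [set c; l] | l in L]].

Definition spanning_class v (C : {set block v}) : Prop :=
  forall x : 'I_v, #|[set B in C | x \in bverts B]| = 1.

Definition URD (isH1 isH2 : forall v, block v -> Prop) (v r s : nat) : Prop :=
  exists C : 'I_(r + s) -> {set block v},
    [/\ forall i, spanning_class (C i),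
        forall i : 'I_(r + s), forall B, B \in C i ->
          if (i < r)%N then isH1 v B else isH2 v B
      & forall e : {set 'I_v}, #|e| = 2 ->
          #|[set p : 'I_(r + s) * block v | (p.2 \in C p.1) && (e \in p.2)]| = 1].

(* Main.v *)
Require Import Defs.
From mathcomp Require Import all_boot all_fingroup all_algebra zify.
Set Implicit Arguments. Unset Strict Implicit. Unset Printing Implicit Defensive.

(** Counting the blocks of a star class and the edges of [K_v] gives [n + 1 | v]
    and [v = 2 (mod n)].

    Conversely put [m = n + 1], [v = m g], [g = k n + 2], and take the vertex set
    [Z_g * Z_m]. Assign to every pair of columns [x, y] a gain [b(x, y) = - b(y, x)]
    in [Z_m], and call the edges [(x, r) - (y, r + b(x, y))] horizontal. For each
    [t < floor(g / 2)] the pairs with [x + y = 2t] or [2t + 1] form a Hamiltonian zigzag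
    path [t, t + 1, t - 1, t + 2, ...] on the columns. A path has no cycle, so the
    gains along it are differences of a potential [a_t]; after colouring [(x, r)] by
    [r - a_t x], the non-horizontal edges over a pair of the path join each vertex to
    exactly one vertex of every other colour. With the edges inside the two end
    columns of the path, every vertex has exactly two neighbours of each other
    colour, and these edges split into [m] classes, one per colour of the centres.
    As this works for any gains, they can be chosen so that the horizontal edges also
    split into classes: for [k = 2q] the gains run cyclically through [1, ..., n] as
    [y - x] goes from [1] to [g/2 - 1], and [y - x = g/2] gives the 1-factor; for
    [k = 2q + 1] the pairs [x + y = -1] lie on none of the paths and are absorbed by
    one special family of [m] classes and by the 1-factor. *)

(** * Necessity *)

Lemma bverts_K2 v (x y : 'I_v) : bverts [set [set x; y]] = [set x; y].
Proof. by rewrite /bverts big_set1. Qed.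

Lemma bverts_star v (c : 'I_v) (L : {set 'I_v}) :
  L != set0 -> bverts [set [set c; l] | l in L] = c |: L.
Proof.
move=> /set0Pn[l0 l0L]; apply/setP=> x; apply/bigcupP/setU1P.
  by move=> [_ /imsetP[l lL ->]]; rewrite !inE => /orP[/eqP->|/eqP->]; [left|right].
case=> [->|xL]; first by exists [set c; l0]; [apply: imset_f | rewrite set21].
by exists [set c; x]; [apply: imset_f | rewrite set22].
Qed.

Lemma pair_inj v (c : 'I_v) (L : {set 'I_v}) :
  c \notin L -> {in L &, injective (fun l => [set c; l])}.
Proof.
move=> cL l l' lL l'L /= E; have: l \in [set c; l'] by rewrite -E set22.
by rewrite !inE => /orP[/eqP lc|/eqP //]; rewrite -lc lL in cL.
Qed.

Lemma card_star_edges v (c : 'I_v) (L : {set 'I_v}) :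
  c \notin L -> #|[set [set c; l] | l in L]| = #|L|.
Proof. by move=> cL; apply: card_in_imset; apply: pair_inj. Qed.

(** Double counting of the incident pairs of a vertex and a block. *)
Lemma sum_bverts v (C : {set block v}) (w : nat) :
  spanning_class C -> (forall B, B \in C -> #|bverts B| = w) -> #|C| * w = v.
Proof.
move=> span Cw.
transitivity (\sum_(B in C) \sum_(x | x \in bverts B) 1).
  rewrite -sum_nat_const; apply: eq_bigr => B BC; by rewrite sum1_card Cw.
rewrite (exchange_big_dep predT) //=.
rewrite (eq_bigr (fun=> 1)) ?sum1_card ?card_ord // => x _.
by rewrite -[RHS](span x) -sum1_card; apply: eq_bigl => B; rewrite inE.
Qed.

(** Double counting of the pairs of an edge and an occurrence of a block through it; an occurrence
    carries the index of its class. *)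
Lemma sum_edges (K : finType) v (C : K -> {set block v}) :
  (forall i B e, B \in C i -> e \in B -> #|e| = 2) ->
  (forall e : {set 'I_v}, #|e| = 2 ->
     #|[set p : K * block v | (p.2 \in C p.1) && (e \in p.2)]| = 1) ->
  \sum_i \sum_(B in C i) #|B| = 'C(v, 2).
Proof.
move=> C2 Ce.
rewrite -[in RHS](card_ord v) -(card_draws 'I_v 2) -sum1_card.
transitivity (\sum_(e : {set 'I_v} | #|e| == 2)
    \sum_(p : K * block v | (p.2 \in C p.1) && (e \in p.2)) 1); last first.
  apply: eq_big => [e|e /eqP e2].
    by rewrite in_set.
  by rewrite -[RHS](Ce e e2) -sum1_card; apply: eq_bigl => p; rewrite inE.
rewrite (exchange_big_dep (fun p : K * block v => p.2 \in C p.1)) /=; last first.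
  by move=> e p _ /andP[].
rewrite pair_big_dep /=; apply: eq_bigr => p pC.
rewrite -[LHS]sum1_card; apply: eq_bigl => e; rewrite pC /=.
case: (boolP (e \in p.2)) => ep; last by rewrite andbF.
by rewrite andbT (C2 _ _ _ pC ep).
Qed.

Lemma URD_modn n v s : 1 < n -> 0 < v -> 0 < s ->
  URD (fun w => @isK2 w) (fun w => @isStar n w) v 1 s ->
  v = 2 * (n + 1) %[mod n * (n + 1)].
Proof.
move=> n1 v0 s0 [C [span blk edg]].
have n0 : 0 < n by lia.
have LN0 (L : {set 'I_v}) : #|L| = n -> L != set0.
  by move=> Ln; rewrite -card_gt0 Ln.
have starE i B : 0 < (i : 'I_(1 + s)) -> B \in C i -> #|B| = n /\ #|bverts B| = n.+1.
  move=> i0 BC; have := blk i B BC; rewrite ltnNge i0 /= => -[c [L [Ln cL ->]]].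
  by rewrite card_star_edges // bverts_star ?LN0 // cardsU1 cL Ln.
have k2E i B : (i : 'I_(1 + s)) = 0 :> nat -> B \in C i -> #|B| = 1 /\ #|bverts B| = 2.
  move=> i0 BC; have := blk i B BC; rewrite i0 /= => -[x [y [xy ->]]].
  by rewrite cards1 bverts_K2 cards2 xy.
have E2 i B e : B \in C i -> e \in B -> #|e| = 2.
  move=> BC; case: (posnP i) => i0; have := blk i B BC.
    rewrite i0 /=; by move=> [x [y [xy ->]]]; rewrite inE => /eqP ->; rewrite cards2 xy.
  rewrite ltnNge i0 /= => -[c [L [Ln cL ->]]] /imsetP[l lL ->]; rewrite cards2.
  by case: eqP => // cl; rewrite cl lL in cL.
have tot := sum_edges E2 edg.
rewrite big_ord_recl /= in tot.
have C0 : #|C ord0| * 2 = v.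
  by apply: sum_bverts => // B BC; case: (k2E ord0 B _ BC).
have Ci (i : 'I_s) : #|C (lift ord0 i)| * n.+1 = v.
  by apply: sum_bverts => // B BC; case: (starE (lift ord0 i) B _ BC).
rewrite (eq_bigr (fun=> 1)) in tot; last by move=> B BC; case: (k2E ord0 B _ BC).
rewrite sum_nat_const muln1 in tot.
have Cn (i : 'I_s) : (\sum_(B in C (lift ord0 i)) #|B|) * n.+1 = n * v.
  rewrite (eq_bigr (fun=> n)); last by move=> B BC; case: (starE (lift ord0 i) B _ BC).
  by rewrite sum_nat_const mulnAC Ci mulnC.
have tot2 : (\sum_(i < s) \sum_(B in C (lift ord0 i)) #|B|) * n.+1 = s * (n * v).
  by rewrite big_distrl /= (eq_bigr _ (fun i _ => Cn i)) sum_nat_const card_ord.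
have dv : n.+1 %| v by apply/dvdnP; exists #|C (lift ord0 (Ordinal s0))|; rewrite Ci.
have b2 : 'C(v, 2) * 2 = v * v.-1 by rewrite bin2 muln2 halfK -[v in odd (v * _)](prednK v0) oddM /= andNb subn0.
(* This is the edge count [v / 2 + s n v / (n + 1) = v (v - 1) / 2], multiplied by [2 (n + 1)] and
   divided by [v]. Modulo [n] it reads [v - 1 = 1]. *)
have key : v.-1 * n.+1 = n.+1 + 2 * s * n.
  apply/eqP; rewrite -(eqn_pmul2l v0); apply/eqP.
  rewrite mulnA -b2 -tot.
  rewrite mulnDl C0 mulnDl mulnAC tot2 mulnDr; congr addn.
  by clear; lia.
have vn : v = 2 %[mod n].
  have -> : v = v.-1 + 1 by lia.
  have K : v.-1 + v.-1 * n = 1 + (1 + 2 * s) * n by rewrite -mulnS key mulnDl mul1n addnA.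
  have : v.-1 = 1 %[mod n].
    by rewrite -(modnMDl v.-1 v.-1) addnC K addnC modnMDl.
  by move=> E; rewrite -modnDml E modnDml.
(* Since [n] and [n + 1] are coprime, the residues [2] and [0] of [v] determine it modulo the
   product. *)
apply/eqP; rewrite addn1 chinese_remainder ?coprimenS //; apply/andP; split.
  apply/eqP; rewrite vn (_ : 2 * n.+1 = 2 * n + 2); [by rewrite modnMDl | lia].
by rewrite modnMl; apply/eqP/eqP.
Qed.

(** * Designs from leaf-to-centre maps *)

Lemma sum_ge1_eq1 (T : finType) (P : pred T) (N : T -> nat) :
  (forall i, P i -> 0 < N i) -> \sum_(i | P i) N i = #|P| -> forall i, P i -> N i = 1.
Proof.
move=> N1 tot i Pi; move: tot; rewrite -sum1_card.
rewrite (bigD1 i) //= [RHS](bigD1 i) //=.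
have le1 : \sum_(j | P j && (j != i)) 1 <= \sum_(j | P j && (j != i)) N j.
  by apply: leq_sum => j /andP[Pj _]; apply: N1.
move=> E; apply/eqP; rewrite eqn_leq (N1 i Pi) andbT.
by rewrite -(leq_add2r (\sum_(j | P j && (j != i)) N j)) E leq_add2l.
Qed.

(** Each [phi i] encodes a star class: it fixes the centres and sends every leaf to its centre. The
    involution [f] encodes the 1-factor. *)
Section FromMaps.
Variables (n v s : nat) (phi : 'I_s -> 'I_v -> 'I_v) (f : 'I_v -> 'I_v).
Hypothesis n0 : 0 < n.
Hypothesis phiK : forall i x, phi i (phi i x) = phi i x.
Hypothesis card_fiber : forall i y, phi i y = y -> #|[set x | phi i x == y]| = n.+1.
Hypothesis fK : involutive f.
Hypothesis fN : forall x, f x != x.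
Hypothesis count : v * n.+1 = 2 * s * n + 2 * n.+1.
Hypothesis cover : forall x y, x != y ->
  f x = y \/ exists i, phi i x = y \/ phi i y = x.

(* Since every pair is covered by [cover] and [count] is the exact number of edges,
   no pair is covered twice. *)
Let N (p : 'I_v * 'I_v) :=
  \sum_i ((phi i p.1 == p.2) + (phi i p.2 == p.1)) + (f p.1 == p.2).

Let leaves i (y : 'I_v) := [set x | phi i x == y] :\ y.

Lemma card_leaves i y : phi i y = y -> #|leaves i y| = n.
Proof.
move=> iy; have := cardsD1 y [set x | phi i x == y].
by rewrite card_fiber // inE iy eqxx => -[].
Qed.

(** The fibres of [phi i] over its centres partition the vertices, and [n] of the [n + 1] points of
    each fibre are leaves. *)
Lemma sum_nonfixed i : (\sum_(p : 'I_v * 'I_v | p.1 != p.2) (phi i p.1 == p.2)) * n.+1 = n * v.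
Proof.
have E : \sum_(y | phi i y == y) n.+1 = v.
  rewrite -[RHS]card_ord -sum1_card [RHS](partition_big (phi i) (fun y => phi i y == y)) /=.
    apply: eq_bigr => y /eqP iy; rewrite -(card_fiber iy) -sum1_card.
    by apply: eq_bigl => x; rewrite inE.
  by move=> x _; rewrite phiK.
have -> : \sum_(p : 'I_v * 'I_v | p.1 != p.2) (phi i p.1 == p.2) =
          \sum_(y | phi i y == y) n.
  transitivity (\sum_y \sum_(x | x != y) (phi i x == y)).
    rewrite pair_big_dep /= (reindex_inj (h := fun p : 'I_v * 'I_v => (p.2, p.1))) //=.
    by move=> [? ?] [? ?] [-> ->].
  rewrite [RHS]big_mkcond; apply: eq_bigr => y _.
  case: eqP => iy.
    rewrite -(card_leaves iy) -sum1_card big_mkcond [RHS]big_mkcond.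
    by apply: eq_bigr => x _; rewrite !inE; case: eqP => //=; case: eqP.
  by apply: big1 => x _; case: eqP => // xy; case: iy; rewrite -xy phiK.
by move: E; rewrite !sum_nat_const => E; rewrite -[v in RHS]E mulnCA mulnA.
Qed.

(** Over ordered pairs a star class contributes [2 n v / (n + 1)] and the 1-factor [v]; by [count]
    the total is [v (v - 1)]. Both sides are multiplied by [n + 1] to avoid the division. *)
Lemma sum_N : \sum_(p | p.1 != p.2) N p = #|[pred p : 'I_v * 'I_v | p.1 != p.2]|.
Proof.
have cE : #|[pred p : 'I_v * 'I_v | p.1 != p.2]| = v * v - v.
  have := cardC [pred p : 'I_v * 'I_v | p.1 == p.2].
  rewrite card_prod !card_ord.
  have -> : #|[pred p : 'I_v * 'I_v | p.1 == p.2]| = v.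
    have inj : injective (fun x : 'I_v => (x, x)) by move=> x y [].
    rewrite -[RHS]card_ord -(card_image inj); apply: eq_card => -[x y]; rewrite inE /=.
    apply/eqP/imageP => [->|[z _ [-> ->]] //]; by exists y.
  by move=> <-; rewrite addKn; apply: eq_card => p; rewrite !inE.
have sF : \sum_(p : 'I_v * 'I_v | p.1 != p.2) (f p.1 == p.2) = v.
  transitivity (\sum_(x : 'I_v) \sum_(y | x != y) (f x == y)).
    by rewrite pair_big_dep.
  rewrite -[RHS]card_ord -sum1_card; apply: eq_bigr => x _.
  rewrite (bigD1 (f x)) /= ?[x == _]eq_sym ?fN // eqxx big1 // => y /andP[_].
  by rewrite eq_sym => /negPf ->.
apply/eqP; rewrite -(eqn_pmul2r (ltn0Sn n)) cE; apply/eqP.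
rewrite /N big_split /= sF mulnDl big_distrl /=.
rewrite (eq_bigr (fun p : 'I_v * 'I_v => \sum_i ((phi i p.1 == p.2) * n.+1 + (phi i p.2 == p.1) * n.+1))); last first.
  by move=> p _; rewrite big_distrl /=; apply: eq_bigr => i _; rewrite mulnDl.
rewrite exchange_big /= (eq_bigr (fun=> 2 * (n * v))); last first.
  move=> i _; rewrite big_split /= -!big_distrl /= sum_nonfixed.
  rewrite (reindex_inj (h := fun p : 'I_v * 'I_v => (p.2, p.1))) /=; last first.
    by move=> [? ?] [? ?] [-> ->].
  rewrite (eq_bigl (fun p : 'I_v * 'I_v => p.1 != p.2)) ?sum_nonfixed; last first.
    by move=> p; rewrite eq_sym.
  by rewrite mul2n addnn.
rewrite sum_nat_const card_ord mulnBl -mulnA count; nia.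
Qed.

Lemma N_eq1 x y : x != y -> N (x, y) = 1.
Proof.
move=> xy; apply: (sum_ge1_eq1 (P := fun p : 'I_v * 'I_v => p.1 != p.2)) => //; last exact: sum_N.
move=> [a b] /= ab; rewrite /N /=; case: (cover ab) => [->|[i ii]].
  by rewrite eqxx addn1.
by rewrite (bigD1 i) //= !addn_gt0 !lt0b; case: ii => ->; rewrite eqxx ?orbT.
Qed.

Definition K2_class : {set block v} := [set [set [set x; f x]] | x in 'I_v].

Definition star_at i (y : 'I_v) : block v := [set [set y; l] | l in leaves i y].

Definition star_class i : {set block v} := [set star_at i y | y in [set y | phi i y == y]].

Definition map_classes (j : 'I_(1 + s)) : {set block v} :=
  match split j with inl _ => K2_class | inr i => star_class i end.

Lemma edge_star_at i y x z : phi i y = y -> x != z ->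
  ([set x; z] \in star_at i y) =
  (phi i x == y) && (z == y) || (phi i z == y) && (x == y).
Proof.
move=> iy xz; apply/imsetP/orP.
  move=> [l]; rewrite !inE => /andP[ly /eqP il] E.
  have: x \in [set y; l] by rewrite -E set21.
  have: z \in [set y; l] by rewrite -E set22.
  rewrite !inE => /orP[] /eqP zE /orP[] /eqP xE; rewrite zE xE ?il ?iy ?eqxx.
  - by rewrite zE xE eqxx in xz.
  - by left.
  - by right.
  by rewrite zE xE eqxx in xz.
case=> /andP[/eqP ix /eqP zy]; rewrite zy in xz *.
  by exists x; rewrite 1?setUC // !inE ix xz eqxx.
by exists z; rewrite // !inE ix eq_sym xz eqxx.
Qed.

Lemma bverts_star_at i y : phi i y = y -> bverts (star_at i y) = [set x | phi i x == y].
Proof.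
move=> iy; rewrite bverts_star; last by rewrite -card_gt0 card_leaves.
by rewrite setD1K // inE iy.
Qed.

Lemma URD_of_maps :
  URD (fun w => @isK2 w) (fun w => @isStar n w) v 1 s.
Proof.
exists map_classes; split.
- move=> j x; rewrite /map_classes; case: (split j) => [_|i].
    apply/eqP/cards1P; exists [set [set x; f x]]; apply/setP => B; rewrite !inE.
    apply/andP/eqP => [[/imsetP[y _ ->]]|->]; last first.
      by rewrite bverts_K2 set21 imset_f.
    by rewrite bverts_K2 !inE => /orP[] /eqP ->; rewrite ?fK // setUC.
  apply/eqP/cards1P; exists (star_at i (phi i x)); apply/setP => B; rewrite !inE.
  apply/andP/eqP => [[/imsetP[y]]|->].
    by rewrite inE => /eqP iy ->; rewrite bverts_star_at // inE => /eqP ->.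
  by rewrite bverts_star_at ?phiK // inE eqxx imset_f // inE phiK.
- move=> j B; rewrite /map_classes; case: splitP => [k _ /imsetP[x _ ->]|i _ /imsetP[y]].
    by exists x, (f x); split; rewrite // eq_sym fN.
  rewrite inE => /eqP iy ->; exists y, (leaves i y).
  by rewrite card_leaves // !inE eqxx.
move=> e /eqP/cards2P[x [z [xz ->]]].
have := N_eq1 xz; rewrite /N /=.
have memK2 : ([set x; z] \in [set [set x; f x]]) = (f x == z).
  rewrite inE; apply/eqP/eqP => [E|->//].
  have: z \in [set x; f x] by rewrite -E set22.
  by rewrite !inE [z == x]eq_sym (negPf xz) => /eqP.
have K2uniq B : B \in K2_class -> [set x; z] \in B -> f x = z /\ B = [set [set x; f x]].
  move=> /imsetP[y _ ->]; rewrite inE => /eqP E.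
  have: x \in [set y; f y] by rewrite -E set21.
  rewrite !inE => /orP[] /eqP xy; move: E; rewrite -?xy => E.
    by split=> //; apply/eqP; rewrite -memK2 E inE.
  have fy : f x = y by rewrite xy fK.
  have E' : [set x; z] = [set x; f x] by rewrite E fy xy setUC.
  by split; [apply/eqP; rewrite -memK2 E' inE | rewrite fy xy setUC].
have starU i B : B \in star_class i -> [set x; z] \in B ->
    phi i x = z /\ B = star_at i z \/ phi i z = x /\ B = star_at i x.
  move=> /imsetP[y]; rewrite inE => /eqP iy ->; rewrite edge_star_at //.
  by case/orP=> /andP[/eqP <- /eqP E]; [left|right]; rewrite -?E; split=> //; congr star_at.
case: (eqVneq (f x) z) => fxz /= tot.
  have tot0 : \sum_i ((phi i x == z) + (phi i z == x)) = 0 by move: tot; rewrite addn1 => -[].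
  apply/eqP/cards1P; exists (lshift s ord0, [set [set x; z]]).
  apply/setP => -[j B]; rewrite !inE /= /map_classes.
  apply/andP/eqP => [[]|[-> ->]]; last first.
    by rewrite (unsplitK (inl ord0)) set11 -fxz imset_f.
  case: splitP => [k jk BK eB|i _ BS eB].
    have [_ ->] := K2uniq _ BK eB; rewrite fxz; congr (_, _).
    by apply: val_inj; rewrite /= jk ord1.
  have /eqP := tot0; rewrite sum_nat_eq0 => /forallP/(_ i) /=.
  by case: (starU _ _ BS eB) => -[-> _]; rewrite eqxx ?addn1.
rewrite addn0 in tot.
have [i iP] : exists i, 0 < (phi i x == z) + (phi i z == x).
  apply/existsP; apply: contraT; rewrite negb_exists => /forallP H; move: tot.
  by rewrite big1 // => i _; have := H i; rewrite -leqNgt leqn0 => /eqP.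
have [one R0] : (phi i x == z) + (phi i z == x) = 1 /\
    \sum_(k | k != i) ((phi k x == z) + (phi k z == x)) = 0.
  move: tot iP; rewrite (bigD1 i) //=; case: ((phi i x == z) + _) => // a.
  by rewrite addSn => -[/eqP]; rewrite addn_eq0 => /andP[/eqP -> /eqP ->].
have rest i' : i' != i -> (phi i' x == z) + (phi i' z == x) = 0.
  move=> ii'; move/eqP: R0; rewrite sum_nat_eq0 => /forallP/(_ i').
  by rewrite ii' => /eqP.
(* [c] is the end of the edge that serves as centre in the only class [i] covering it. *)
pose c := if phi i x == z then z else x.
have ic : phi i c = c.
  rewrite /c; case: eqP one => [<-|_]; first by rewrite phiK.
  by rewrite add0n; case: eqP => // <-; rewrite phiK.
apply/eqP/cards1P; exists (rshift 1 i, star_at i c).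
apply/setP => -[j B]; rewrite !inE /= /map_classes.
apply/andP/eqP => [[]|[-> ->]]; last first.
  rewrite (unsplitK (inr i)) imset_f ?inE ?ic // edge_star_at //; split=> //.
  rewrite /c; case: (eqVneq (phi i x) z) one => [E|_]; first by rewrite E !eqxx.
  by rewrite add0n; case: eqP => // _ _; rewrite !eqxx orbT.
case: splitP => [k _ BK eB|i' ji' BS eB].
  by have [E] := K2uniq _ BK eB; rewrite E eqxx in fxz.
have ii' : i' = i.
  apply/eqP; apply: contraT => /rest.
  by case: (starU _ _ BS eB) => -[-> _]; rewrite eqxx ?addn1.
subst i'; congr (_, _); first by apply: val_inj.
case: (starU _ _ BS eB) => -[E ->]; rewrite /c; first by rewrite E eqxx.
by move: one; rewrite E eqxx; case: (phi i x == z).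
Qed.

End FromMaps.

(** Transport along enumerations, so that vertices may be pairs of a column and a row. *)
Lemma URD_of_fin_maps (V S : finType) (n : nat) (phi : S -> V -> V) (f : V -> V) :
  0 < n ->
  (forall i x, phi i (phi i x) = phi i x) ->
  (forall i y, phi i y = y -> #|[set x | phi i x == y]| = n.+1) ->
  involutive f -> (forall x, f x != x) ->
  #|V| * n.+1 = 2 * #|S| * n + 2 * n.+1 ->
  (forall x y, x != y -> f x = y \/ exists i, phi i x = y \/ phi i y = x) ->
  URD (fun w => @isK2 w) (fun w => @isStar n w) #|V| 1 #|S|.
Proof.
move=> n0 phiK cfib fK fN cnt cov.
pose phi' (i : 'I_#|S|) (x : 'I_#|V|) := enum_rank (phi (enum_val i) (enum_val x)).
apply: (URD_of_maps (phi := phi') (f := fun x => enum_rank (f (enum_val x)))) => //.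
- by move=> i x; rewrite /phi' enum_rankK phiK.
- move=> i y iy; have iy' : phi (enum_val i) (enum_val y) = enum_val y.
    by rewrite -[in RHS]iy enum_rankK.
  rewrite -(cfib _ _ iy') -(card_imset _ enum_val_inj); apply: eq_card => x.
  apply/imsetP/idP => [[z zP ->]|xP].
    by move: zP; rewrite !inE => /eqP <-; rewrite enum_rankK.
  exists (enum_rank x); rewrite ?enum_rankK // !inE /phi' enum_rankK.
  by move: xP; rewrite inE => /eqP ->; rewrite enum_valK.
- by move=> x; rewrite enum_rankK fK enum_valK.
- by move=> x; rewrite -(inj_eq enum_val_inj) enum_rankK fN.
move=> x y; rewrite -(inj_eq enum_val_inj) => /cov [E|[i ii]].
  by left; rewrite E enum_valK.
right; exists (enum_rank i); rewrite /phi' enum_rankK.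
by case: ii => ->; rewrite enum_valK; [left|right].
Qed.

Section Constructions.
Import GRing.Theory.
Local Open Scope ring_scope.

(** * Star classes from colourings *)

Section ColourMap.
Variables (I : finType) (Z : finZmodType).
Variables (gam : Z) (a : I -> Z) (pi : Z -> I -> I).
Hypothesis pi0 : pi 0 =1 id.
Hypothesis pi_inj : forall b, injective (pi b).

(* The vertex [(i, r)] has colour [r - a i]. The centres are the vertices of colour
   [gam]; a leaf of colour [gam - b] in column [i] is sent to the centre in column
   [pi b i]. *)
Definition cmap (x : I * Z) : I * Z :=
  let j := pi (gam - (x.2 - a x.1)) x.1 in (j, gam + a j).

Lemma cmapK x : cmap (cmap x) = cmap x.
Proof. by rewrite /cmap /= addrK subrr pi0. Qed.

(** For each [b] exactly one vertex of colour [gam - b] is sent to [y]: the vertex [F b], in the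
    column that [pi b] moves to the column of [y]. *)
Lemma card_cmap_fiber y : cmap y = y -> #|[set x | cmap x == y]| = #|Z|.
Proof.
move=> yK; have y2 : y.2 = gam + a y.1 by rewrite -[in LHS]yK -[in RHS]yK.
pose g b := invF (@pi_inj b) y.1; pose F b := (g b, gam - b + a (g b)).
have pg b : pi b (g b) = y.1 by rewrite /g f_invF.
have FE b : gam - ((F b).2 - a (F b).1) = b by rewrite /= addrK subKr.
have Finj : injective F by move=> b b' E; rewrite -[b]FE E FE.
rewrite -(card_codom Finj); apply: eq_card => x; rewrite inE.
apply/eqP/codomP => [xy|[b ->]]; last first.
  by rewrite /cmap FE /= pg -y2; case: (y).
exists (gam - (x.2 - a x.1)).
have gx : g (gam - (x.2 - a x.1)) = x.1.
  by apply: (@pi_inj (gam - (x.2 - a x.1))); rewrite pg -xy.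
by rewrite /F gx subKr subrK; case: (x).
Qed.

End ColourMap.

Lemma cmap0E (I : finType) (Z : finZmodType) (gam : Z) (pi : Z -> I -> I) x r :
  cmap gam (fun=> 0) pi (x, r) = (pi (gam - r) x, gam).
Proof. by rewrite /cmap /= addr0 subr0. Qed.

(** * Zigzag paths and potentials *)

Section ZigZag.
Variable G : nat.
Local Notation I := 'I_G.+2.

(* Position of [z] on the path [0, 1, -1, 2, -2, ...]; truncated predecessor makes it
   [0] at [z = 0]. *)
Definition zigzag_idx (z : I) : nat :=
  (if z.*2 <= G.+2 then z.*2.-1 else (G.+2 - z).*2)%N.

Lemma zigzag_idx_lt z : (zigzag_idx z < G.+2)%N.
Proof. by rewrite /zigzag_idx; have := ltn_ord z; case: (leqP z.*2 G.+2); lia. Qed.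

Lemma zigzag_idx_inj : injective (fun z => Ordinal (zigzag_idx_lt z)).
Proof.
move=> z z' [] E; apply: val_inj => /=; move: E.
rewrite /zigzag_idx; have := ltn_ord z; have := ltn_ord z'.
by case: (leqP z.*2 G.+2); case: (leqP z'.*2 G.+2); lia.
Qed.

Definition zigzag : {perm I} := perm zigzag_idx_inj.

Lemma zigzagE z : zigzag z = zigzag_idx z :> nat. Proof. by rewrite permE. Qed.

Lemma zigzag_consec z z' (e : bool) : z != z' -> z + z' = e%:R ->
  zigzag z' = (zigzag z).+1 :> nat \/ zigzag z = (zigzag z').+1 :> nat.
Proof.
move=> zz' E; have {zz'} : (z : nat) <> z' by move/val_inj/eqP; apply/negP.
have {E} : ((z + z') %% G.+2 = e)%N.
  by have := congr1 val E; rewrite Zp_nat /= => ->; case: (e); rewrite modn_small.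
rewrite !zigzagE /zigzag_idx.
have := ltn_ord z; have := ltn_ord z'; move: (val z) (val z') => {}z {}z' lz' lz.
(* Without wrap-around the two columns are [0] and [1]; otherwise their integer sum is
   [G.+2 + e]. *)
case: (ltnP (z + z') G.+2) => [l|l]; first rewrite modn_small //.
  by case: e; case: (leqP z.*2 G.+2); case: (leqP z'.*2 G.+2); lia.
rewrite -(subnK l) modnDr modn_small; last by lia.
by case: e; case: (leqP z.*2 G.+2); case: (leqP z'.*2 G.+2); lia.
Qed.

Variables (Z : zmodType) (bet : I -> I -> Z).
Hypothesis betN : forall x y, bet y x = - bet x y.

(** The sum of the gains along the zigzag path translated by [t], from its start [t] to [x]. *)
Definition pot (t x : I) : Z :=
  \sum_(0 <= i < zigzag (x - t))
    bet (t + zigzag^-1%g (inord i)) (t + zigzag^-1%g (inord i.+1)).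

Lemma pot_step t x y : zigzag (y - t) = (zigzag (x - t)).+1 :> nat ->
  pot t y - pot t x = bet x y.
Proof.
move=> E; rewrite /pot E big_nat_recr //= [LHS]addrC addKr -E !inord_val.
by rewrite !permK ![t + _]addrC !subrK.
Qed.

(** Translation by [- t] reduces the sum to [e], so [x] and [y] are consecutive on the path;
    antisymmetry of [bet] handles the reverse order. *)
Lemma pot_diff t x y (e : bool) : x != y -> x + y = t + t + e%:R ->
  pot t y - pot t x = bet x y.
Proof.
move=> xy E; have xy' : x - t != y - t by rewrite (inj_eq (addIr _)).
have E' : x - t + (y - t) = e%:R.
  by rewrite addrACA E -opprD addrAC subrr add0r.
case: (zigzag_consec xy' E') => /pot_step H; first exact: H.
by rewrite -[RHS]opprK -betN -H opprB.
Qed.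

End ZigZag.

(** * Gains, path classes and shift classes *)

Section Construction.
Variables G N : nat.
Local Notation I := 'I_G.+2.
Local Notation Z := 'I_N.+2.

(* [c] prescribes the gain of the differences [1 <= d < g / 2], with [g = G.+2]. *)
Definition gain (c : nat -> nat) (d : I) : Z :=
  if d == 0 then 0
  else if (d.*2 < G.+2)%N then (c d)%:R
  else if (d.*2 == G.+2)%N then 0 else - (c (G.+2 - d)%N)%:R.

Lemma val_oppI (d : I) : d != 0 -> (- d : I) = (G.+2 - d)%N :> nat.
Proof.
move=> d0; have : (d : nat) <> 0%N by move=> E; case/eqP: d0; apply: val_inj.
by have := ltn_ord d; move=> ? ?; rewrite /= modn_small //; lia.
Qed.

Lemma gainN c d : gain c (- d) = - gain c d.
Proof.
rewrite /gain oppr_eq0; case: (eqVneq d 0) => [|d0]; first by rewrite oppr0.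
rewrite val_oppI //.
have dN : (d : nat) <> 0%N by move=> E; case/eqP: d0; apply: val_inj.
move: (nat_of_ord d) (ltn_ord d) dN => {d0} {}d ld dN.
rewrite subKn; last exact: ltnW.
case: (ltngtP d.*2 G.+2) => h.
- have -> : ((G.+2 - d).*2 < G.+2)%N = false by lia.
  by have -> : ((G.+2 - d).*2 == G.+2)%N = false by lia.
- have -> : ((G.+2 - d).*2 < G.+2)%N = true by lia.
  by rewrite opprK.
have -> : ((G.+2 - d).*2 < G.+2)%N = false by lia.
have -> : ((G.+2 - d).*2 == G.+2)%N = true by lia.
by rewrite oppr0.
Qed.

Section Diagonal.
Variable bet : I -> I -> Z.
Hypothesis betN : forall x y, bet y x = - bet x y.

(* A colour [gam] centre and a colour [gam - b] leaf are joined over [2t + 1] or [2t]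
   according to which colour is smaller, so that each edge has exactly one of its two
   ends as a leaf. *)
Definition diag_perm (t : I) (gam b : Z) (i : I) : I :=
  if b == 0 then i else t + t + ((gam - b)%R < gam)%N%:R - i.

Definition diag_map t gam := cmap gam (pot bet t) (diag_perm t gam).

Lemma diag_perm_inj t gam b : injective (diag_perm t gam b).
Proof. by rewrite /diag_perm; move=> x y; case: eqP => // _ /addrI/oppr_inj. Qed.

Lemma diag_mapE t x y r s (e : bool) :
  x + y = t + t + e%:R ->
  r - pot bet t x != s - pot bet t y ->
  e = ((r - pot bet t x)%R < (s - pot bet t y)%R)%N :> bool ->
  diag_map t (s - pot bet t y) (x, r) = (y, s).
Proof.
set gam := s - _; set al := r - _ => xy ne eE.
have jE : diag_perm t gam (gam - al) x = y.
  rewrite /diag_perm subr_eq0 eq_sym (negPf ne) subKr -eE -xy addrAC subrr.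
  exact: add0r.
by rewrite /diag_map /cmap [in LHS]/fst [in LHS]/snd jE subrK.
Qed.

(** The second hypothesis makes the two colours distinct. Then exactly one orientation of the edge
    orders them as [e] requires, and it decides which end is the leaf. *)
Lemma diag_cover t x y r s (e : bool) :
  x + y = t + t + e%:R -> (if x == y then r != s else s - r != bet x y) ->
  exists gam, diag_map t gam (x, r) = (y, s) \/ diag_map t gam (y, s) = (x, r).
Proof.
move=> xy ne.
have ne' : r - pot bet t x != s - pot bet t y.
  move: ne; case: eqP => [<-|/eqP nxy]; first by rewrite (inj_eq (addIr _)).
  apply: contraNneq => E; rewrite -(pot_diff betN nxy xy).
  by rewrite -[r](subrK (pot bet t x)) E opprD addrA subKr.
case: (boolP (e == ((r - pot bet t x)%R < (s - pot bet t y)%R)%N)) => [/eqP eE|eN].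
  by exists (s - pot bet t y); left; apply: (diag_mapE xy).
exists (r - pot bet t x); right; apply: (@diag_mapE t y x s r e).
- by rewrite addrC.
- by rewrite eq_sym.
move: eN; have : nat_of_ord (r - pot bet t x) <> nat_of_ord (s - pot bet t y).
  by move/val_inj/eqP; apply/negP.
by case: ltngtP => //; case: (e).
Qed.

(** The path is given by half the residue of [x + y], and [e] by its parity. *)
Lemma diag_cover_lt w (x y : I) (r s : Z) :
  (nat_of_ord (x + y)%R < w.*2)%N -> (if x == y then r != s else s - r != bet x y) ->
  exists (t : 'I_w) gam,
    diag_map (t : nat)%:R gam (x, r) = (y, s) \/ diag_map (t : nat)%:R gam (y, s) = (x, r).
Proof.
move=> lt ne; have lt' : ((nat_of_ord (x + y)%R)./2 < w)%N by rewrite ltn_half_double.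
exists (Ordinal lt') => /=; apply: (@diag_cover _ _ _ _ _ (odd (nat_of_ord (x + y)))) => //.
by rewrite -!natrD addnn addnC odd_double_half natr_Zp.
Qed.

End Diagonal.

Section Shift.
Variable psi : {perm I}.

(** Columns are renumbered by [psi], and a leaf whose row differs from the centre's by [b] moves
    [d b] columns on; so [d] picks one column difference per gain. *)
Definition shift_perm (d : Z -> I) (b : Z) (i : I) : I :=
  if b == 0 then i else psi^-1%g (psi i + d b).

Lemma shift_perm_inj d b : injective (shift_perm d b).
Proof.
by rewrite /shift_perm => x y; case: eqP => // _ /perm_inj/addIr/perm_inj.
Qed.

Lemma shift_cover d x y r s : s != r -> psi y - psi x = d (s - r) ->
  cmap s (fun=> 0) (shift_perm d) (x, r) = (y, s).
Proof.
move=> sr E; rewrite cmap0E /shift_perm subr_eq0 (negPf sr) -E addrC subrK.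
by rewrite permK.
Qed.

End Shift.

End Construction.

Lemma ord_natr p k : ((k%:R : 'I_p.+2) = k %% p.+2 :> nat)%N.
Proof. by rewrite Zp_nat. Qed.

Lemma val_Zp_neq0 p (d : 'I_p.+2) : d != 0 -> (0 < nat_of_ord d)%N.
Proof. by rewrite lt0n. Qed.

Lemma gainE (G N : nat) (c : nat -> nat) (x : 'I_G.+2) :
  x != 0 -> (x.*2 < G.+2)%N -> gain N c x = (c x)%:R.
Proof. by move=> /negPf x0 xl; rewrite /gain x0 xl. Qed.

(** * The case [v = (n + 1) (2 q n + 2)] *)

Section Even.
Variables q N : nat.
Local Notation G := ((q * N.+1).*2)%N.
Local Notation w := (q * N.+1).+1.
Local Notation I := 'I_G.+2.
Local Notation Z := 'I_N.+2.

Definition even_col (d : nat) := (d.-1 %% N.+1).+1.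
Definition even_gain (x y : I) : Z := gain N even_col (y - x).

Lemma even_gainN x y : even_gain y x = - even_gain x y.
Proof. by rewrite /even_gain -gainN opprB. Qed.

Definition even_class (i : ('I_w + 'I_q) * Z) : I * Z -> I * Z :=
  match i.1 with
  | inl t => diag_map even_gain (t : nat)%:R i.2
  | inr u => cmap i.2 (fun=> 0) (shift_perm 1%g (fun b => (u * N.+1 + b)%N%:R))
  end.

Definition even_factor (x : I * Z) : I * Z := (x.1 + w%:R, x.2).

(** Dividing [y - x - 1] by [n = N.+1] gives the family [u] as quotient and the gain minus one as
    remainder. *)
Lemma even_cover_shift (x y : I) (r s : Z) :
  y != x -> ((y - x)%R.*2 < G.+2)%N -> s - r = even_gain x y ->
  exists i, even_class i (x, r) = (y, s).
Proof.
move=> yx lt E; have d0 : y - x != 0 by rewrite subr_eq0.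
move: E; rewrite /even_gain gainE // => E.
have dp := val_Zp_neq0 d0.
have uq : ((nat_of_ord (y - x)%R).-1 %/ N.+1 < q)%N.
  rewrite ltn_divLR //; move: lt dp; move: (nat_of_ord (y - x)%R) => d.
    by move: (q * N.+1)%N => p; lia.
have sr : nat_of_ord (s - r) = even_col (y - x)%R.
  by rewrite E ord_natr modn_small // ltnS ltn_pmod.
exists (inr (Ordinal uq), s); rewrite /even_class; apply: shift_cover.
  by apply/eqP => /= E0; move: sr; rewrite E0 subrr.
rewrite !perm1 -[LHS]natr_Zp; congr (_%:R); rewrite [in RHS]sr.
by rewrite /even_col addnS -[LHS](prednK dp); congr succn; apply: divn_eq.
Qed.

Theorem URD_even :
  URD (fun v => @isK2 v) (fun v => @isStar N.+1 v) (G.+2 * N.+2) 1 ((w + q) * N.+2).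
Proof.
have cV : #|{: I * Z}| = (G.+2 * N.+2)%N by rewrite card_prod !card_ord.
have cS : #|{: ('I_w + 'I_q) * Z}| = ((w + q) * N.+2)%N.
  by rewrite card_prod card_sum !card_ord.
have wG : (w + w = G.+2)%N by lia.
have ww : w%:R + w%:R = 0 :> I.
  by rewrite -natrD wG; apply: val_inj; have := ord_natr G G.+2; rewrite modnn.
have w0 : w%:R != 0 :> I.
  apply/eqP => /(congr1 (@nat_of_ord _)); rewrite ord_natr modn_small //.
  by rewrite -wG; lia.
rewrite -cV -cS; apply: (URD_of_fin_maps (phi := even_class) (f := even_factor)) => //.
- move=> [[t|u] gam] x; apply: cmapK => b; rewrite /diag_perm /shift_perm eqxx //.
- move=> [[t|u] gam] y yK; rewrite (card_cmap_fiber _ yK) ?card_ord //.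
  + by move=> b; apply: diag_perm_inj.
  + by move=> b; apply: shift_perm_inj.
- by move=> [x r]; rewrite /even_factor /= -addrA ww addr0.
- by move=> [x r]; rewrite xpair_eqE negb_and /= -subr_eq0 [x + _]addrC addrK w0.
- by rewrite cV cS; clear; nia.
move=> [x r] [y s] xy.
have diag : (if x == y then r != s else s - r != even_gain x y) ->
    exists i, even_class i (x, r) = (y, s) \/ even_class i (y, s) = (x, r).
  (* Here [G.+2 = 2 w], so every pair of columns lies on one of the [w] paths. *)
  move=> ne; have [|t [gam H]] := @diag_cover_lt _ _ _ even_gainN w x y r s _ ne.
    by apply: leq_trans (ltn_ord (x + y)) _; lia.
  by exists (inl t, gam).
case: (eqVneq x y) => [exy|nxy] in diag.
  by right; apply: diag; apply: contraNneq xy => ->; rewrite exy.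
case: (eqVneq (s - r) (even_gain x y)) => [E|/diag]; last by right.
(* A horizontal edge is read in the direction of the shorter column difference; at half the order
   its gain is [0] and it lies in the 1-factor. *)
case: (ltngtP (y - x)%R.*2 G.+2) => lt.
- right; have [|i H] := @even_cover_shift x y r s _ lt E; first by rewrite eq_sym.
  by exists i; left.
- right; have [//||i H] := @even_cover_shift y x s r nxy.
  + rewrite -opprB val_oppI ?subr_eq0 1?eq_sym //.
    by have := ltn_ord (y - x); move: lt; move: (nat_of_ord (y - x)) => d; lia.
  + by rewrite even_gainN -E opprB.
  by exists i; right.
left; rewrite /even_factor /=; move: E; rewrite /even_gain /gain lt ltnn eqxx.
rewrite subr_eq0 [y == x]eq_sym (negPf nxy) => /eqP; rewrite subr_eq0 => /eqP ->.
have -> : w%:R = y - x; last by rewrite addrC subrK.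
by rewrite -[y - x]natr_Zp; congr (_%:R); move: lt wG; move: (nat_of_ord _) => d; lia.
Qed.

End Even.

(** * The case [v = (n + 1) ((2 q + 1) n + 2)], with [n = 2 p + 1] *)

Section Odd.
Variables q p : nat.
Local Notation N := p.*2.
Local Notation G := ((q * N.+1).*2 + N.+1)%N.
Local Notation w := (q * N.+1 + p.+1)%N.
Local Notation I := 'I_G.+2.
Local Notation Z := 'I_N.+2.

Lemma odd_order : (w + w).+1 = G.+2.
Proof. by lia. Qed.

Lemma natr_w : w%:R + w%:R = -1 :> I.
Proof.
apply/eqP; rewrite -subr_eq0 opprK -natrD -[1]/(1%:R) -natrD addn1 odd_order.
by apply/eqP/val_inj; have := ord_natr G G.+2; rewrite modnn.
Qed.

Lemma natr_half : p.+1%:R + p.+1%:R = 0 :> Z.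
Proof.
rewrite -natrD (_ : (p.+1 + p.+1 = N.+2)%N); last by lia.
by apply: val_inj; have := ord_natr N N.+2; rewrite modnn.
Qed.

Lemma val_half : nat_of_ord (p.+1%:R : Z) = p.+1.
Proof. by rewrite ord_natr modn_small //; lia. Qed.

(** The order [2 w + 1] is odd, so doubling is injective, and [2 w = -1]. *)
Lemma antipode_fixed (x : I) : -1 - x = x -> x = w%:R.
Proof.
move=> E; have {E} : nat_of_ord (x + x) = nat_of_ord (w%:R + w%:R : I).
  by congr nat_of_ord; rewrite natr_w; apply/eqP; rewrite eq_sym -subr_eq E.
have := ord_natr G w; rewrite modn_small; last by rewrite -odd_order; lia.
move=> wE E; apply: val_inj; rewrite /= in E *; rewrite wE in E *.
move: E (ltn_ord x); move: (nat_of_ord x) => {}x; rewrite -odd_order.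
rewrite [RHS]modn_small; last by lia.
move=> E xl; move: E; case: (ltnP (x + x) (w + w).+1) => [l|l]; first by rewrite modn_small //; lia.
by rewrite -(subnK l) modnDr modn_small; lia.
Qed.

Lemma odd_psi_inj : injective (fun x : I => zigzag G (x - w%:R)).
Proof. by move=> x y /perm_inj/addIr. Qed.

(* The new column numbering follows the zigzag path from [w], the fixed point of
   [x |-> -1 - x]; it makes the pairs [x + y = -1] consecutive, hence of gain [p + 1],
   the element of order 2. *)
Definition odd_psi : {perm I} := perm odd_psi_inj.

Lemma odd_psiE x : odd_psi x = zigzag G (x - w%:R). Proof. exact: permE. Qed.

Lemma odd_psi_consec (x y : I) : x != y -> x + y = -1 ->
  odd_psi y - odd_psi x = 1 \/ odd_psi x - odd_psi y = 1.
Proof.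
have step (i j : I) : j = i.+1 :> nat -> j - i = 1.
  by move=> ji; rewrite -[j]natr_Zp ji -natr1 natr_Zp addrAC subrr add0r.
move=> xy E; rewrite !odd_psiE.
have xyw : x - w%:R != y - w%:R by rewrite (inj_eq (addIr _)).
have E0 : x - w%:R + (y - w%:R) = false%:R by rewrite addrACA E -opprD natr_w subrr.
by case: (zigzag_consec xyw E0) => /step H; [left|right]; exact: H.
Qed.

(** The differences [1, ..., p + 1] take each gain [1, ..., p + 1] once, with [p + 1] moved to
    [d = 1]; they serve the special family. From [p + 2] to [w] the gains make [q] full turns
    through [1, ..., n]. *)
Definition odd_col (d : nat) :=
  if (d == 1)%N then p.+1 else if (d <= p.+1)%N then d.-1 else ((d - p.+2) %% N.+1).+1.

Lemma odd_col_lt d : (odd_col d < N.+2)%N.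
Proof.
rewrite /odd_col; case: eqP => _; first by lia.
by case: (leqP d p.+1) => H; [lia | rewrite ltnS ltn_pmod].
Qed.

Definition odd_gain (x y : I) : Z := gain N odd_col (odd_psi y - odd_psi x).

Lemma odd_gainN x y : odd_gain y x = - odd_gain x y.
Proof. by rewrite /odd_gain -gainN opprB. Qed.

(** The inverse of [odd_col] on the differences [1, ..., p + 1]. *)
Definition special_step (b : Z) : I :=
  if (b == p.+1 :> nat)%N then 1 else b.+1%:R.

(* Colour differences below [p + 1] use horizontal edges, those above use the edges
   over [x + y = -1]. For [p + 1] all consecutive columns are joined, which mixes
   both kinds. *)
Definition odd_special (b : Z) (i : I) : I :=
  if (b <= p.+1)%N then shift_perm odd_psi special_step b i else -1 - i.

Lemma odd_special_inj b : injective (odd_special b).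
Proof.
rewrite /odd_special; case: (b <= p.+1)%N; first exact: shift_perm_inj.
by move=> x y /addrI/oppr_inj.
Qed.

Definition odd_class (i : ('I_w + option 'I_q) * Z) : I * Z -> I * Z :=
  match i.1 with
  | inl t => diag_map odd_gain (t : nat)%:R i.2
  | inr (Some u) =>
      cmap i.2 (fun=> 0) (shift_perm odd_psi (fun b => (p.+1 + u * N.+1 + b)%N%:R))
  | inr None => cmap i.2 (fun=> 0) odd_special
  end.

(** The reflection [x |-> -1 - x] fixes column [w], which is therefore matched within itself by the
    row shift of order 2; this shift exists because [n] is odd. *)
Definition odd_factor (x : I * Z) : I * Z :=
  if x.1 == w%:R then (x.1, x.2 + p.+1%:R) else (-1 - x.1, x.2).

Lemma special_classE x r s : odd_class (inr None, s) (x, r) = (odd_special (s - r) x, s).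
Proof. exact: cmap0E. Qed.

Lemma special_shift (x y : I) (r s : Z) : s != r -> ((s - r)%R <= p.+1)%N ->
  odd_psi y - odd_psi x = special_step (s - r) ->
  odd_class (inr None, s) (x, r) = (y, s).
Proof.
move=> sr le E; rewrite special_classE /odd_special le.
by have := shift_cover (d := special_step) sr E; rewrite cmap0E.
Qed.

Lemma odd_cover_shift (x y : I) (r s : Z) :
  y != x -> ((odd_psi y - odd_psi x)%R.*2 < G.+2)%N -> s - r = odd_gain x y ->
  exists i, odd_class i (x, r) = (y, s).
Proof.
move=> yx lt E.
have d0 : odd_psi y - odd_psi x != 0 by rewrite subr_eq0 (inj_eq perm_inj).
move: E; rewrite /odd_gain gainE // => E.
have dp := val_Zp_neq0 d0.
have dE := natr_Zp (odd_psi y - odd_psi x).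
have dw : (nat_of_ord (odd_psi y - odd_psi x)%R <= w)%N.
  move: lt; move: (nat_of_ord (odd_psi y - odd_psi x)) => d.
  by rewrite -odd_order; lia.
have sr : nat_of_ord (s - r) = odd_col (odd_psi y - odd_psi x)%R.
  by rewrite E ord_natr modn_small // odd_col_lt.
move: sr dE dp dw; move: (nat_of_ord (odd_psi y - odd_psi x)) => d sr dE dp dw.
have srN : s != r.
  apply/eqP => E0; move: sr; rewrite E0 subrr /odd_col.
  by case: eqP => // d1; case: leqP => //= _; lia.
case: (ltnP p.+1 d) => dh.
  have uq : ((d - p.+2) %/ N.+1 < q)%N.
    by rewrite ltn_divLR //; move: dw; lia.
  exists (inr (Some (Ordinal uq)), s); rewrite /odd_class.
  apply: shift_cover => //; rewrite -[LHS]dE; congr (_%:R); rewrite [in RHS]sr.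
  rewrite /odd_col leqNgt dh /=; case: eqP => [|_]; first by lia.
  by rewrite addnS -addnA -divn_eq; lia.
exists (inr None, s); apply: special_shift; rewrite // /special_step sr /odd_col dh.
  by case: eqP => // _; lia.
case: (d =P 1%N) => [d1|d1]; first by rewrite eqxx -dE d1.
have -> : (d.-1 == p.+1)%N = false by lia.
by rewrite prednK // -dE.
Qed.

(** Row difference [0] goes to the 1-factor when [x] and [y] differ. Any other difference except
    [p + 1] exceeds [p + 1] in one of the two directions, where the special family reflects. For
    [p + 1] the columns are consecutive for [odd_psi], or both equal [w] and the 1-factor
    applies. *)
Lemma odd_cover_antipode (x y : I) (r s : Z) :
  x + y = -1 -> (x, r) != (y, s) ->
  odd_factor (x, r) = (y, s) \/
  exists i, odd_class i (x, r) = (y, s) \/ odd_class i (y, s) = (x, r).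
Proof.
move=> xy ne; have yE : y = -1 - x by rewrite -xy addrC addKr.
have xE : x = -1 - y by rewrite -xy addrK.
have far (x' y' : I) (r' s' : Z) : y' = -1 - x' -> (p.+1 < (s' - r')%R)%N ->
    odd_class (inr None, s') (x', r') = (y', s').
  by move=> y'E lt; rewrite special_classE /odd_special leqNgt lt y'E.
case: (eqVneq s r) => [E|sr].
  left; rewrite /odd_factor /= E; case: eqP => [xw|_]; last by rewrite yE.
  by move: ne; rewrite E yE xw -natr_w addrK eqxx.
have sr0 : s - r != 0 by rewrite subr_eq0.
case: (ltngtP p.+1 (s - r)%R) => lt.
- by right; exists (inr None, s); left; apply: far.
- right; exists (inr None, r); right; apply: far => //.
  rewrite -opprB val_oppI //; have := val_Zp_neq0 sr0.
  by move: lt; move: (nat_of_ord (s - r)) => d; lia.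
have srh : s - r = p.+1%:R by rewrite -[LHS]natr_Zp -lt.
case: (eqVneq x y) => [exy|nxy].
  have xw : x = w%:R by apply: antipode_fixed; rewrite -yE.
  by left; rewrite /odd_factor /= -xw eqxx -srh addrC subrK exy.
right; case: (odd_psi_consec nxy xy) => E.
  by exists (inr None, s); left; apply: special_shift; rewrite // /special_step -lt ?eqxx.
(* [p + 1] is its own negative, so reversing the edge keeps the row difference. *)
have rsh : nat_of_ord (r - s) = p.+1.
  by rewrite -opprB srh -[LHS]/(nat_of_ord (- _)) -[- _]add0r -natr_half addrK val_half.
exists (inr None, r); right; apply: special_shift; rewrite /special_step ?rsh ?eqxx // eq_sym //.
Qed.

Theorem URD_odd :
  URD (fun v => @isK2 v) (fun v => @isStar N.+1 v) (G.+2 * N.+2) 1 ((w + q.+1) * N.+2).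
Proof.
have cV : #|{: I * Z}| = (G.+2 * N.+2)%N by rewrite card_prod !card_ord.
have cS : #|{: ('I_w + option 'I_q) * Z}| = ((w + q.+1) * N.+2)%N.
  by rewrite card_prod card_sum card_option !card_ord.
have fxN x : x != w%:R -> -1 - x != w%:R :> I.
  apply: contraNneq => E; rewrite -[x](subKr (-1)) E -natr_w addrK eqxx //.
rewrite -cV -cS; apply: (URD_of_fin_maps (phi := odd_class) (f := odd_factor)) => //.
- move=> [[t|[u|]] gam] x; apply: cmapK => b.
  + by rewrite /diag_perm eqxx.
  + by rewrite /shift_perm eqxx.
  + by rewrite /odd_special /shift_perm eqxx.
- move=> [[t|[u|]] gam] y yK; rewrite (card_cmap_fiber _ yK) ?card_ord //.
  + by move=> b; apply: diag_perm_inj.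
  + by move=> b; apply: shift_perm_inj.
  + by move=> b; apply: odd_special_inj.
- move=> [x r]; rewrite /odd_factor /=; case: (eqVneq x w%:R) => xw /=.
    by rewrite xw eqxx -addrA natr_half addr0.
  by rewrite (negPf (fxN _ xw)) subKr.
- move=> [x r]; rewrite /odd_factor /=; case: (eqVneq x w%:R) => xw /=.
    rewrite xpair_eqE negb_and; apply/orP; right; rewrite -subr_eq0 [r + _]addrC addrK.
    by apply/eqP => /(congr1 (@nat_of_ord _)); rewrite val_half.
  by rewrite xpair_eqE negb_and; apply/orP; left; apply: contraNneq xw => /antipode_fixed/eqP.
- by rewrite cV cS; clear; nia.
move=> [x r] [y s] xy.
(* The only residue of [x + y] missed by the paths is [2 w = -1]. *)
case: (ltnP (x + y)%R w.*2) => [lt|ge]; last first.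
  apply: odd_cover_antipode => //; rewrite -natr_w -natrD -[LHS]natr_Zp addnn.
  congr (_%:R); move: ge (ltn_ord (x + y)); move: (nat_of_ord (x + y)) => d.
  by rewrite -odd_order; lia.
right; have diag : (if x == y then r != s else s - r != odd_gain x y) ->
    exists i, odd_class i (x, r) = (y, s) \/ odd_class i (y, s) = (x, r).
  move=> ne; have [t [gam H]] := diag_cover_lt odd_gainN lt ne.
  by exists (inl t, gam).
case: (eqVneq x y) => [exy|nxy] in diag.
  by apply: diag; apply: contraNneq xy => ->; rewrite exy.
case: (eqVneq (s - r) (odd_gain x y)) => [E|/diag //].
case: (ltnP (odd_psi y - odd_psi x)%R.*2 G.+2) => dlt.
  have [|i H] := @odd_cover_shift x y r s _ dlt E; first by rewrite eq_sym.
  by exists i; left.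
have [//||i H] := @odd_cover_shift y x s r nxy.
- rewrite -opprB val_oppI ?subr_eq0 ?(inj_eq perm_inj) 1?eq_sym //.
  move: dlt (ltn_ord (odd_psi y - odd_psi x)).
  by move: (nat_of_ord (odd_psi y - odd_psi x)) => d; rewrite -odd_order; lia.
- by rewrite odd_gainN -E opprB.
by exists i; right.
Qed.

End Odd.

End Constructions.

Theorem mainTheorem1 (n : nat) (hn : (1 < n)%N) (hodd : odd n) (v : nat) (hv : (0 < v)%N) :
  (exists s : nat, (0 < s)%N /\ URD (fun w => @isK2 w) (fun w => @isStar n w) v 1 s) <->
  v = (2 * (n + 1)) %[mod n * (n + 1)].
Proof.
split=> [[s [s0 urd]]|vE]; first exact: URD_modn urd.
have [p nE] : exists p, n = p.*2.+1.
  by exists n./2; rewrite -[LHS]odd_double_half hodd.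
(* An odd [n > 1] is at least [3], so [2 (n + 1)] is already reduced modulo [n (n + 1)]. *)
have {vE} vE : v = v %/ (n * (n + 1)) * (n * (n + 1)) + 2 * (n + 1).
  rewrite [LHS](divn_eq v (n * (n + 1))) vE modn_small //.
  by rewrite ltn_pmul2r ?addn1 //; lia.
move: (v %/ _) vE => k vE.
(* The number of columns is [k n + 2], and the parity of [k] selects the construction. *)
have kE := odd_double_half k; case: (odd k) kE => /= kE.
  exists ((k./2 * n + p.+1 + k./2.+1) * n.+1); split; first by rewrite muln_gt0 addnS.
  have -> : v = ((k./2 * n).*2 + n).+2 * n.+1.
    by rewrite vE -{1}kE; move: (k./2) => q; clear; nia.
  by rewrite nE; apply: URD_odd.
exists (((k./2 * n).+1 + k./2) * n.+1); split; first by rewrite muln_gt0.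
have -> : v = (k./2 * n).*2.+2 * n.+1.
  by rewrite vE -{1}kE; move: (k./2) => q; clear; nia.
by rewrite nE; apply: URD_even.
Qed.
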